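(* Let $G$ be the directed graph on vertex set $\{0,1,\dots,8\}$, where vertex $v$ belongs to gender class $v \bmod 3$, with the following $16$ ranked edges. Rank $1$: $(0,1)$, $(1,2)$, $(2,3)$, $(3,4)$, $(4,5)$, $(5,0)$, $(6,4)$, $(7,8)$, $(8,0)$. Rank $2$: $(4,8)$, $(8,6)$, $(0,7)$, $(1,5)$, $(5,3)$, $(3,1)$. Rank $3$: $(4,2)$. Then this instance of 3DSMI of dimension $3$ has no stable matching.
   Context: An instance of 3DSMI of dimension $n$ is a directed graph $G$ without multiple edges whose vertex set is partitioned into three gender classes of size $n$ each, cyclically ordered (men $\to$ women $\to$ dogs $\to$ men), with every edge going from a class to the next class in this cyclic order (here from class $i$ to class $i+1 \bmod 3$). Each edge $(v,v')$ carries a positive integer rank $r(v,v')$, and for every vertex $v$ of out-degree $k$ the ranks of edges leaving $v$ are exactly $1,\dots,k$. A family is a directed $3$-cycle of $G$. A matching $\mathcal M$ is a set of pairwise vertex-disjoint families. For a vertex $v$, $R_{\mathcal M}(v)$ is the rank of the edge leaving $v$ within its family in $\mathcal M$, and $R_{\mathcal M}(v)=+\infty$ if $v$ lies in no family of $\mathcal M$. A directed $3$-cycle $(v,v',v'')$ of $G$ is blocking for $\mathcal M$ if $r(v,v')<R_{\mathcal M}(v)$, $r(v',v'')<R_{\mathcal M}(v')$ and $r(v'',v)<R_{\mathcal M}(v'')$. A matching is stable if it has no blocking triple. *)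

(* Defs.v *)
From mathcomp Require Import all_boot.

Set Implicit Arguments.
Unset Strict Implicit.
Unset Printing Implicit Defensive.

(* The value [rank u v] is only meaningful when [edge u v] holds. *)
Record ranked_digraph (V : finType) := RankedDigraph {
  edge : rel V;
  rank : V -> V -> nat
}.

Record is_3DSMI (n : nat) (V : finType) (gender : V -> 'I_3)
    (G : ranked_digraph V) : Prop := Is3DSMI {
  gender_card : forall c : 'I_3, #|[set v | gender v == c]| = n;
  (* [ordS] is the successor modulo 3 on 'I_3 *)
  edge_gender : forall u v : V, edge G u v -> gender v = ordS (gender u);
  (* as a multiset, so distinct edges leaving u have distinct ranks *)
  rank_out : forall u : V,
    perm_eq [seq rank G u v | v in edge G u] (iota 1 #|[set v | edge G u v]|)
}.

Section Matchings.

Variables (V : finType) (G : ranked_digraph V).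

(* A directed 3-cycle is listed from any of its vertices; its three rotations
   share vertices, so at most one of them occurs in a matching. *)
Definition family (t : 3.-tuple V) : bool := cycle (edge G) t && uniq t.

Definition matching (M : {set 3.-tuple V}) : Prop :=
  (forall t, t \in M -> family t) /\
  (forall t1 t2, t1 \in M -> t2 \in M -> t1 != t2 -> [disjoint t1 & t2]).

(* [None] stands for +oo.  When M is a matching, at most one t in M contains v. *)
Definition matched_rank (M : {set 3.-tuple V}) (v : V) : option nat :=
  if [pick t in M | v \in t] is Some t then Some (rank G v (next t v)) else None.

Definition rank_lt (k : nat) (r : option nat) : bool :=
  if r is Some m then k < m else true.

Definition blocking (M : {set 3.-tuple V}) (v v' v'' : V) : bool :=
  [&& family [tuple v; v'; v''],
      rank_lt (rank G v v') (matched_rank M v),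
      rank_lt (rank G v' v'') (matched_rank M v')
    & rank_lt (rank G v'' v) (matched_rank M v'')].

Definition stable (M : {set 3.-tuple V}) : Prop :=
  ~ exists v v' v'' : V, blocking M v v' v''.

End Matchings.

Definition rank1_edges : seq (nat * nat) :=
  [:: (0, 1); (1, 2); (2, 3); (3, 4); (4, 5); (5, 0); (6, 4); (7, 8); (8, 0)].

Definition rank2_edges : seq (nat * nat) :=
  [:: (4, 8); (8, 6); (0, 7); (1, 5); (5, 3); (3, 1)].

Definition rank3_edges : seq (nat * nat) := [:: (4, 2)].

Definition G9 : ranked_digraph 'I_9 := {|
  edge := fun u v =>
    (val u, val v) \in rank1_edges ++ rank2_edges ++ rank3_edges;
  rank := fun u v =>
    if (val u, val v) \in rank1_edges then 1
    else if (val u, val v) \in rank2_edges then 2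
    else 3
|}.

Definition gender9 (v : 'I_9) : 'I_3 := Ordinal (ltn_pmod v (isT : 0 < 3)).

(* Main.v *)
Require Import Defs.
From mathcomp Require Import all_boot.

Set Implicit Arguments.
Unset Strict Implicit.
Unset Printing Implicit Defensive.

(** G9 has only seven families: 015, 078, 345, 342, 312, 315 and 648.
    Stability says that every family contains a vertex that likes some family
    of M at least as much.  If 015 is in M, it excludes all other families but
    342 and 648; then 648 does not block only if it is in M, and 312 does not
    block only if 342 is in M, yet both contain 4.  Otherwise, as 078 does not
    block, it is in M and excludes 648, and as 015 does not block, M contains 312
    or 315; in the first case 345 blocks, in the second case 342 does. *)

(** Enumerations of ['I_n] do not evaluate; lists filtered from [iota 0 n] do, so the 3DSMI axioms
    for [G9] reduce to computation. *)
Lemma image_ord (n : nat) (T : Type) (f : nat -> T) (P : pred nat) :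
  [seq f (val v) | v in [pred v : 'I_n | P v]] = [seq f k | k <- iota 0 n & P k].
Proof.
by rewrite -val_enum_ord filter_map -map_comp /image_mem {1}/enum_mem -enumT.
Qed.

Lemma card_ord_pred (n : nat) (P : pred nat) :
  #|[set v : 'I_n | P v]| = count P (iota 0 n).
Proof.
have := congr1 size (image_ord n id P).
by rewrite !size_map size_filter -cardE cardsE.
Qed.

Definition edges9 : seq (nat * nat) :=
  rank1_edges ++ rank2_edges ++ rank3_edges.

Definition rank9 (u v : nat) : nat :=
  if (u, v) \in rank1_edges then 1 else if (u, v) \in rank2_edges then 2 else 3.

Lemma G9_is_3DSMI : is_3DSMI 3 gender9 G9.
Proof.
split=> [c|u v|u].
- rewrite (card_ord_pred 9 (fun k => k %% 3 == val c)).
  by case: c => [[|[|[|]]]].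
- move=> uv; apply: val_inj => /=; rewrite -[(u %% 3).+1]addn1 modnDml addn1.
  have /allP/(_ _ uv)/eqP // : all (fun p => p.2 %% 3 == p.1.+1 %% 3) edges9 by [].
- rewrite (card_ord_pred 9 (fun k => (val u, k) \in edges9)).
  rewrite (image_ord 9 (rank9 u) (fun k => (val u, k) \in edges9)).
  by case: u; do 9?[case=> //].
Qed.

Definition families9 : seq (seq nat) :=
  [:: [:: 0; 1; 5]; [:: 0; 7; 8]; [:: 3; 4; 5]; [:: 3; 4; 2]; [:: 3; 1; 2];
      [:: 3; 1; 5]; [:: 6; 4; 8]].

(* [finfun] shadows [family], hence the qualified name. *)
Lemma family9P (t : 3.-tuple 'I_9) :
  Defs.family G9 t -> exists2 c, c \in families9 &
    exists2 i, i < 3 & map val t = rot i c.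
Proof.
(* Exhaustive search: all pairs of consecutive edges that a third edge closes to a triangle. *)
have closed9 : all (fun p => all (fun q => (p.2 == q.1) ==>
    ((q.2, p.1) \in edges9) ==>
    has (fun c => has (fun i => [:: p.1; p.2; q.2] == rot i c) (iota 0 3))
      families9) edges9) edges9 by [].
case/tupleP: t => x t; case/tupleP: t => y t; case/tupleP: t => z t.
rewrite (tuple0 t) => /andP[/= /and4P[xy yz zx _] _].
move/allP/(_ _ xy)/allP/(_ _ yz): closed9.
move/implyP/(_ (eqxx _))/implyP/(_ zx)/hasP => [c c9 /hasP[i i3 /eqP tc]].
by exists c => //; exists i => //; rewrite mem_iota in i3.
Qed.

(** As [t] does not block, one of its vertices fails its [rank_lt] test. That vertex is matched,
    since an unmatched one has rank [None] and passes. *)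
Lemma stable_at_family (V : finType) (G : ranked_digraph V)
    (M : {set 3.-tuple V}) (t : 3.-tuple V) :
  stable G M -> Defs.family G t ->
  exists2 s, s \in M &
    has (fun v => (v \in s) && (rank G v (next s v) <= rank G v (next t v))) t.
Proof.
move=> stM; have unblocked v k : ~~ rank_lt k (matched_rank G M v) ->
    exists2 s, s \in M & (v \in s) && (rank G v (next s v) <= k).
  rewrite /matched_rank; case: pickP => //= s /andP[sM vs].
  by rewrite -leqNgt; exists s; rewrite ?vs.
case/tupleP: t => x t; case/tupleP: t => y t; case/tupleP: t => z t.
rewrite (tuple0 t) => fam.
have /andP[_ /and3P[]] := fam; rewrite !inE negb_or => /andP[xy xz] yz _.
have /negP : ~ blocking G M x y z by move=> b; apply: stM; exists x, y, z.
have -> : blocking G M x y z = [&& true, rank_lt (rank G x y) (matched_rank G M x),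
      rank_lt (rank G y z) (matched_rank G M y)
    & rank_lt (rank G z x) (matched_rank G M z)] by rewrite -fam.
(* Unfolding [next] leaves equality tests between vertices, decided by their distinctness. *)
rewrite /= !eqxx (eq_sym y x) (eq_sym z x) (eq_sym z y).
rewrite (negbTE xy) (negbTE xz) (negbTE yz) !negb_and.
by case/or3P => /unblocked[s sM le_s]; exists s => //; rewrite le_s ?orbT.
Qed.

(** If [d] is in the matching, it keeps [c] from blocking. Plain lists make this decidable by
    evaluation. *)
Definition deters (d c : seq nat) : bool :=
  has (fun v => (v \in d) && (rank9 v (next d v) <= rank9 v (next c v))) c.

(** The rotation is needed because a matching may list a family from any of its vertices. *)
Definition selected (M : {set 3.-tuple 'I_9}) (c : seq nat) : bool :=
  [exists t in M, [exists i : 'I_3, map val t == rot i c]].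

Lemma next_val_rot (t : seq 'I_9) (c : seq nat) (i : nat) (v : 'I_9) :
  uniq t -> map val t = rot i c -> val (next t v) = next c (val v).
Proof.
move=> ut tc; rewrite -(next_map val_inj ut) tc next_rot //.
by rewrite -(rot_uniq i) -tc map_inj_uniq //; apply: val_inj.
Qed.

Lemma family9_tuple (c : seq nat) : c \in families9 ->
  exists2 t : 3.-tuple 'I_9, Defs.family G9 t & map val t = c.
Proof.
have ok9 : all (fun c => [&& size c == 3, all (gtn 9) c, uniq c &
    cycle (fun u v => (u, v) \in edges9) c]) families9 by [].
move=> /(allP ok9)/and4P[sz lt9 uc cyc].
have valc : map val (map (fun k => inord k : 'I_9) c) = c.
  by rewrite -map_comp -[RHS]map_id; apply/eq_in_map => k /(allP lt9) /inordK.
have szt : size (map (fun k => inord k : 'I_9) c) == 3 by rewrite size_map.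
exists (Tuple szt) => //; apply/andP; split => /=.
  by rewrite -valc cycle_map in cyc.
by rewrite -(map_inj_uniq val_inj) valc.
Qed.

(** Carries [stable_at_family] over to lists of naturals, where the filtered list of candidates can
    be computed. *)
Lemma stable_deterred (M : {set 3.-tuple 'I_9}) (c : seq nat) :
  matching G9 M -> stable G9 M -> c \in families9 ->
  has (selected M) [seq d <- families9 | deters d c].
Proof.
move=> [famM _] stM /family9_tuple[t famt tc].
have [s sM /hasP[v vt /andP[vs le_v]]] := stable_at_family stM famt.
have [d d9 [i i3 sd]] := family9P (famM s sM).
have [/andP[_ ut] /andP[_ us]] := (famt, famM s sM).
apply/hasP; exists d; last first.
  by apply/exists_inP; exists s => //; apply/existsP; exists (Ordinal i3); apply/eqP.
rewrite mem_filter d9 andbT; apply/hasP; exists (val v); first by rewrite -tc map_f.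
rewrite -(mem_rot i) -sd map_f //= -(next_val_rot v us sd).
by rewrite -(next_val_rot (i := 0) v ut) ?rot0.
Qed.

Lemma selected_meet (M : {set 3.-tuple 'I_9}) (c d : seq nat) :
  matching G9 M -> selected M c -> selected M d -> has (mem c) d ->
  exists i j, rot i c = rot j d.
Proof.
move=> [_ disjM] /exists_inP[s sM /existsP[i /eqP sc]].
move=> /exists_inP[t tM /existsP[j /eqP td]] /hasP[k kd kc].
exists i, j; rewrite -sc -td; apply/eqP; apply: contraTT kc => nst /=.
have {}nst : s != t by apply: contra nst => /eqP->.
move: kd; rewrite -(mem_rot j) -td => /mapP[v vt ->].
rewrite -(mem_rot i) -sc (mem_map val_inj).
by apply: contraL vt => vs; rewrite (disjointFr (disjM s t sM tM nst)).
Qed.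

(** Families of a matching that meet coincide up to rotation; [perm_eq] is a rotation invariant that
    evaluates. *)
Lemma selected_exclusive (M : {set 3.-tuple 'I_9}) (c d : seq nat) :
  matching G9 M -> selected M c -> has (mem c) d -> ~~ perm_eq c d ->
  ~~ selected M d.
Proof.
move=> mM sc cd; apply: contra => sd.
have [i [j ij]] := selected_meet mM sc sd cd.
by rewrite -(perm_rot i) ij perm_rot.
Qed.

Theorem theorem3 :
  is_3DSMI 3 gender9 G9 /\
  ~ exists M : {set 3.-tuple 'I_9}, matching G9 M /\ stable G9 M.
Proof.
split; first exact: G9_is_3DSMI.
case=> M [mM stM].
have cover c := @stable_deterred M c mM stM.
have excl c d := @selected_exclusive M c d mM.
pose f015 := [:: 0; 1; 5]; pose f078 := [:: 0; 7; 8]; pose f345 := [:: 3; 4; 5].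
pose f342 := [:: 3; 4; 2]; pose f312 := [:: 3; 1; 2]; pose f315 := [:: 3; 1; 5].
pose f648 := [:: 6; 4; 8].
(* Each list is the value of the filter by [deters], accepted by conversion. *)
have cover015 : has (selected M) [:: f015; f312; f315] := cover f015 isT.
have cover078 : has (selected M) [:: f015; f078] := cover f078 isT.
have cover345 : has (selected M) [:: f015; f345; f342; f315] := cover f345 isT.
have cover342 : has (selected M) [:: f345; f342; f312; f648] := cover f342 isT.
have cover312 : has (selected M) [:: f345; f342; f312; f315] := cover f312 isT.
have cover648 : has (selected M) [:: f078; f345; f648] := cover f648 isT.
have [s015 | n015] := boolP (selected M f015).
  have n078 : ~~ selected M f078 by apply: excl s015 _ _.
  have n345 : ~~ selected M f345 by apply: excl s015 _ _.
  have n312 : ~~ selected M f312 by apply: excl s015 _ _.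
  have n315 : ~~ selected M f315 by apply: excl s015 _ _.
  have s648 : selected M f648.
    by move: cover648; rewrite /= (negbTE n078) (negbTE n345) orbF.
  have s342 : selected M f342.
    by move: cover312; rewrite /= (negbTE n345) (negbTE n312) (negbTE n315) !orbF.
  by rewrite (negbTE (excl _ f648 s342 isT isT)) in s648.
have s078 : selected M f078 by move: cover078; rewrite /= (negbTE n015) orbF.
have n648 : ~~ selected M f648 by apply: excl s078 _ _.
(* Both 312 and 315 contain 3, hence exclude 345 and 342. *)
have [s312 | n312] := boolP (selected M f312).
  have n345 : ~~ selected M f345 by apply: excl s312 _ _.
  have n342 : ~~ selected M f342 by apply: excl s312 _ _.
  have n315 : ~~ selected M f315 by apply: excl s312 _ _.
  by move: cover345; rewrite /= !orbF -!implyNb n015 n345 n342 (negbTE n315).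
have s315 : selected M f315.
  by move: cover015; rewrite /= (negbTE n015) (negbTE n312) orbF.
have n345 : ~~ selected M f345 by apply: excl s315 _ _.
have n342 : ~~ selected M f342 by apply: excl s315 _ _.
by move: cover342; rewrite /= !orbF -!implyNb n345 n342 n312 (negbTE n648).
Qed.
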